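(* Let $T$ be a tree with independence number $\alpha$. Then $T$ has at most $2^{\alpha-1}+1$ maximum independent sets, with equality if and only if $T$ arises from a star of order $\alpha+1$ by subdividing $\alpha-1$ of its edges once each.
   Context: All graphs are finite, simple and undirected. An independent set of a graph $G$ is a set of pairwise non-adjacent vertices. The independence number $\alpha(G)$ is the maximum cardinality of an independent set of $G$, and a maximum independent set is an independent set of cardinality $\alpha(G)$. A star of order $n$ is the complete bipartite graph $K_{1,n-1}$; subdividing an edge once means replacing it by a path of length $2$ through a new vertex. *)

(* Defs.v *)
From mathcomp Require Import all_boot.

Set Implicit Arguments.
Unset Strict Implicit.
Unset Printing Implicit Defensive.

Record sgraph := SGraph {
  vertex :> finType;
  adj : rel vertex;
  adj_sym : symmetric adj;
  adj_irrefl : irreflexive adj }.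

Definition isomorphic (G H : sgraph) : Prop :=
  exists2 f : G -> H, bijective f & forall x y, adj (f x) (f y) = adj x y.

Definition connected (G : sgraph) : Prop :=
  0 < #|G| /\ forall x y : G, connect (@adj G) x y.

(* [ucycle] also holds of the empty sequence and, for an edge xy, of
   [:: x; y]; graph cycles are those of length at least 3. *)
Definition acyclic (G : sgraph) : Prop :=
  forall c : seq G, ucycle (@adj G) c -> size c < 3.

Definition is_tree (G : sgraph) : Prop := connected G /\ acyclic G.

Definition independent (G : sgraph) (A : {set G}) : bool :=
  [forall x in A, forall y in A, ~~ adj x y].

Definition alpha (G : sgraph) : nat := \max_(A : {set G} | independent A) #|A|.

Definition max_independent_sets (G : sgraph) : {set {set G}} :=
  [set A : {set G} | independent A & #|A| == alpha G].

Definition edges (G : sgraph) : {set {set G}} :=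
  [set f : {set G} | [exists x, exists y, adj x y && (f == [set x; y])]].

Section CompleteBipartite.
Variables m n : nat.

Definition Kbip_adj (u v : 'I_m + 'I_n) : bool :=
  match u, v with
  | inl _, inr _ | inr _, inl _ => true
  | _, _ => false
  end.

Lemma Kbip_sym : symmetric Kbip_adj.
Proof. by case=> ? [?|?]. Qed.

Lemma Kbip_irrefl : irreflexive Kbip_adj.
Proof. by case. Qed.

Definition Kbip : sgraph := SGraph Kbip_sym Kbip_irrefl.

End CompleteBipartite.

Definition star (n : nat) : sgraph := Kbip 1 (n - 1).

Section Subdivide.
Variables (G : sgraph) (S : {set {set G}}).

(* The new vertex on the edge f \in S is [inr f]. *)
Definition subdivide_adj (u v : G + {f : {set G} | f \in S}) : bool :=
  match u, v with
  | inl x, inl y => adj x y && ([set x; y] \notin S)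
  | inl x, inr f | inr f, inl x => x \in val f
  | inr _, inr _ => false
  end.

Lemma subdivide_sym : symmetric subdivide_adj.
Proof. by case=> x [y|y] //=; rewrite adj_sym setUC. Qed.

Lemma subdivide_irrefl : irreflexive subdivide_adj.
Proof. by case=> x //=; rewrite adj_irrefl. Qed.

Definition subdivide : sgraph := SGraph subdivide_sym subdivide_irrefl.

End Subdivide.

(* Main.v *)
Require Import Defs.
From mathcomp Require Import all_boot.

(* A forest has a matching such that some independent set A contains every
   unmatched vertex and one end of each matching edge.  So alpha = #|A|, and a
   maximum independent set is determined by its part outside A; this leaves at
   most 2^(alpha - 1) of them unless the matching is perfect.  If it is, the
   maximum independent sets and their complements are all among the 2^alpha
   transversals of the matching, and by connectedness a set and its complement
   are both independent for at most two sets: twice the number of maximum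
   independent sets is at most 2^alpha + 2.  Equality means that each transversal
   or its complement is independent, which forces any two edges outside the
   matching to meet; having no triangle, they form a star, and the tree is a
   star with all edges but one subdivided. *)

Set Implicit Arguments.
Unset Strict Implicit.
Unset Printing Implicit Defensive.

(** * Independent sets and matchings in acyclic graphs *)

Section Graph.
Variable G : sgraph.
Implicit Types (x y z u v c : G) (X Y A I W : {set G}) (mu : G -> G).

Lemma independentP X :
  reflect {in X &, forall x y, ~~ adj x y} (independent X).
Proof.
apply: (iffP forall_inP) => [H x y xX yX | H x xX].
  by move/forall_inP: (H x xX); apply.
by apply/forall_inP => y yX; apply: H.
Qed.

Lemma leq_alpha X : independent X -> #|X| <= alpha G.
Proof. by exact: (@leq_bigmax_cond _ (@independent G) (fun A : {set G} => #|A|)). Qed.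

Lemma adj_neq x y : adj x y -> x != y.
Proof. by apply: contraTneq => ->; rewrite adj_irrefl. Qed.

Lemma acyclic_triangle_free x y z :
  acyclic G -> adj x y -> adj y z -> adj z x -> False.
Proof.
move=> acG xy yz zx; suff /acG: ucycle (@adj G) [:: x; y; z] by [].
rewrite /ucycle /= xy yz zx !inE (negbTE (adj_neq xy)) (negbTE (adj_neq yz)).
by rewrite eq_sym (negbTE (adj_neq zx)).
Qed.

(* The first vertex of a longest path inside W has no neighbour in W other than
   its successor on the path, as a further one would close a cycle. *)
Lemma acyclic_leaf W : acyclic G -> W != set0 ->
  exists2 v, v \in W &
    forall x y, x \in W -> y \in W -> adj v x -> adj v y -> x = y.
Proof.
move=> acG /set0Pn[w0 w0W].
pose P k := [exists t : k.-tuple G,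
  [&& uniq t, sorted (@adj G) t & all [in W] t]].
have P1 : P 1 by apply/existsP; exists [tuple w0]; rewrite /= w0W.
have Pmax k : P k -> k <= #|G|.
  by case/existsP=> t /and3P[ut _ _]; rewrite -(size_tuple t) -(card_uniqP ut) max_card.
case: (ex_maxnP (ex_intro _ 1 P1) Pmax) => k /existsP[t /and3P[ut pt Wt]] kmax.
have st := size_tuple t; have k1 := kmax 1 P1.
case Et: (tval t) st ut pt Wt => [|v p] /=; first by move=> k0; rewrite -k0 in k1.
move=> sk /andP[vp up] pp /andP[vW pW]; exists v => // x y.
have nbr z : z \in W -> adj v z -> exists p', p = z :: p'.
  move=> zW vz; have zp : z \in p.
    apply: contraT => zp; have /kmax : P k.+1; last by rewrite ltnn.
    have szk : size (z :: v :: p) == k.+1 by rewrite /= sk.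
    apply/existsP; exists (Tuple szk); rewrite /= inE negb_or zp vp up vW zW pW pp.
    by rewrite adj_sym vz eq_sym (adj_neq vz).
  case/splitPr: zp up pp vp {pW sk Et} => -[|a p1] p2 /= up pp vp.
    by exists p2.
  suff /acG : ucycle (@adj G) [:: v, a & rcons p1 z].
    by rewrite /= size_rcons.
  case/andP: pp => va; rewrite -cat_rcons cat_path => /andP[pp _].
  rewrite /ucycle /= rcons_path pp last_rcons va adj_sym vz /=.
  move: vp up; rewrite -cat_rcons -!cat_cons mem_cat negb_or => /andP[-> _] /=.
  by rewrite cat_uniq mem_cat negb_or => /andP[/andP[-> _] /andP[-> _]].
move=> xW yW /(nbr x xW)[p1 Ep] /(nbr y yW)[p2].
by rewrite Ep => -[].
Qed.

(* A matching is encoded as an involution fixing the unmatched vertices. *)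
Lemma acyclic_independent_matching : acyclic G ->
  exists2 A, independent A & exists mu,
    [/\ involutive mu, forall x, mu x != x -> adj x (mu x)
      & forall x, x \notin A -> mu x \in A].
Proof.
(* For an induction on cardinality, [[set: G]] is generalised below to any vertex set [W]: [A] lies
   inside [W] and [mu] fixes every vertex outside it. *)
move=> acG; suff [A [mu [iA _ muK mu_adj [_ muA]]]] : exists A mu,
    [/\ independent A, A \subset [set: G], involutive mu,
        forall x, mu x != x -> adj x (mu x)
      & (forall x, x \notin [set: G] -> mu x = x) /\
        (forall x, x \in [set: G] -> x \notin A -> mu x \in A)].
  by exists A => //; exists mu; split=> // x xA; apply: muA; rewrite ?inE.
move: [set: G] => W; have [k] := ubnP #|W|; elim: k W => // k IH W; rewrite ltnS.
have [-> _ | W0 Wk] := eqVneq W set0.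
  exists set0, id; split=> //; first by apply/independentP=> x y; rewrite inE.
    by move=> x; rewrite eqxx.
have [v vW v1] := acyclic_leaf acG W0.
have extend_indep (W' A : {set G}) : A \subset W' -> independent A ->
    {in W', forall x, ~~ adj v x} -> independent (v |: A).
  move=> sAW' /independentP iA nv; apply/independentP=> x y.
  case/setU1P=> [->|xA] /setU1P[->|yA]; rewrite ?adj_irrefl //.
  - by apply: nv; apply: (subsetP sAW').
  - by rewrite adj_sym; apply: nv; apply: (subsetP sAW').
  - exact: iA.
(* If [v] has no neighbour in [W], it joins [A] unmatched. Otherwise it has a single neighbour [u]
   there, and both are removed before the induction hypothesis is applied. *)
have [[u /andP[uW vu]]|nu] :=
  altP (existsP (P := fun u => (u \in W) && adj v u)); last first.
  rewrite negb_exists in nu; move/forallP: nu => nu.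
  have [|A [mu [iA sA muK mu_adj [muW muA]]]] := IH (W :\ v).
    by move: Wk; rewrite (cardsD1 v) vW.
  exists (v |: A), mu; split=> //.
  - apply: extend_indep sA iA _.
    by move=> x /setD1P[_ xW]; have:= nu x; rewrite xW.
  - by rewrite subUset sub1set vW (subset_trans sA) // subD1set.
  split=> x xW; first by apply: muW; rewrite !inE (negbTE xW) andbF.
  rewrite !inE negb_or => /andP[xv xA]; apply/orP; right.
  by apply: muA; rewrite // !inE xv.
have uv : u != v by rewrite eq_sym adj_neq.
pose W' := W :\ v :\ u.
have sW' : W' \subset W by rewrite (subset_trans (subD1set _ _)) // subD1set.
have [|A [mu [iA sA muK mu_adj [muW muA]]]] := IH W'.
  by move: Wk; rewrite (cardsD1 v) vW (cardsD1 u (W :\ v)) !inE uv uW -/W' => /ltnW.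
have mu_v : mu v = v by apply: muW; rewrite !inE eqxx andbF.
have mu_u : mu u = u by apply: muW; rewrite !inE eqxx.
have mu_fix z : mu z = z -> forall x, (mu x == z) = (x == z).
  by move=> zz x; rewrite -{1}zz (inj_eq (can_inj muK)).
(* [v] joins [A] and is matched to [u]; independence survives because [u], the only neighbour of [v]
   in [W], stays outside [A]. *)
exists (v |: A), (fun x => if x == v then u else if x == u then v else mu x).
split.
- apply: extend_indep sA iA _ => x /setD1P[xu /setD1P[_ xW]].
  by apply: contra xu => vx; rewrite (v1 _ _ xW uW vx vu).
- by rewrite subUset sub1set vW (subset_trans sA).
- move=> x; have [->|xv] := eqVneq x v; first by rewrite (negbTE uv) eqxx.
  have [->|xu] := eqVneq x u; first by rewrite eqxx.
  by rewrite !mu_fix // (negbTE xv) (negbTE xu) muK.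
- move=> x; have [->|xv] := eqVneq x v => //.
  by have [->|xu] := eqVneq x u; [rewrite adj_sym | apply: mu_adj].
split=> x xW.
  have [xv|xv] := eqVneq x v; first by rewrite xv vW in xW.
  have [xu|xu] := eqVneq x u; first by rewrite xu uW in xW.
  by apply: muW; rewrite !inE (negbTE xW) !andbF.
rewrite !inE negb_or => /andP[xv xA]; rewrite (negbTE xv).
have [_|xu] := eqVneq x u; first by rewrite eqxx.
by rewrite muA ?orbT // !inE xu xv.
Qed.

(** * Maximum independent sets relative to a matching and an independent cover *)

Section Matching.
Variables (A : {set G}) (mu : G -> G).
Hypotheses (iA : independent A) (muK : involutive mu).
Hypothesis mu_adj : forall x, mu x != x -> adj x (mu x).
Hypothesis muA : forall x, x \notin A -> mu x \in A.

(** Projects each matching edge onto its end in [A]. An independent set has at most one end of each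
    edge, so the projection is injective on it. *)
Let to_A x := if x \in A then x else mu x.

Lemma independent_mate x I :
  independent I -> x \in I -> mu x \in I -> mu x = x.
Proof.
move=> /independentP iI xI muI; apply/eqP; apply: contraT => /mu_adj.
by rewrite (negbTE (iI _ _ xI muI)).
Qed.

Let to_A_inj I : independent I -> {in I &, injective to_A}.
Proof.
move=> iI x y xI yI; rewrite /to_A.
case: ifP => xA; case: ifP => yA //.
- by move=> Ex; rewrite Ex (@independent_mate y I) // -Ex.
- by move=> Ey; rewrite -Ey (@independent_mate x I) // Ey.
- exact: (can_inj muK).
Qed.

Let to_A_sub I : to_A @: I \subset A.
Proof.
by apply/subsetP=> _ /imsetP[x _ ->]; rewrite /to_A; case: ifPn => // /muA.
Qed.

Lemma alpha_cover : alpha G = #|A|.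
Proof.
apply/eqP; rewrite eqn_leq leq_alpha // andbT; apply/bigmax_leqP => I iI.
by rewrite -(card_in_imset (to_A_inj iI)) subset_leq_card.
Qed.

Lemma card_compl_cover : #|~: A| <= alpha G.
Proof.
rewrite alpha_cover -(card_imset _ (can_inj muK)) subset_leq_card //.
by apply/subsetP=> y /imsetP[x]; rewrite inE => /muA xA ->.
Qed.

(** By cardinality [to_A] maps [I] onto [A], so [I] contains [a] or its mate, and never both ends of
    a matching edge. An unmatched [a] always lies in [I]. *)
Lemma max_independent_mem I a : I \in max_independent_sets G -> a \in A ->
  (a \in I) = (mu a \notin I :\: A).
Proof.
rewrite inE => /andP[iI cI] aA; rewrite inE.
have /eqP EA : to_A @: I == A.
  by rewrite eqEcard to_A_sub (card_in_imset (to_A_inj iI)) (eqP cI) alpha_cover /=.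
apply/idP/idP => [aI|].
  by apply/negP=> /andP[mA mI]; move: mA; rewrite (independent_mate iI aI mI) aA.
apply: contraR => aI; move: (aA); rewrite -{1}EA => /imsetP[x xI].
rewrite /to_A; case: ifPn => xA Ea; first by rewrite Ea xI in aI.
by rewrite Ea muK xA xI.
Qed.

(** A maximum independent set is determined by its part outside [A]. *)
Lemma card_max_independent_sets_le : #|max_independent_sets G| <= 2 ^ #|~: A|.
Proof.
rewrite -card_powerset -[leqLHS](card_in_imset (f := fun I => I :\: A)).
  apply: subset_leq_card; apply/subsetP=> _ /imsetP[I _ ->].
  by rewrite powersetE setDE subsetIr.
move=> I J mI mJ EIJ; apply/setP=> x; have [xA|xA] := boolP (x \in A).
  by rewrite (max_independent_mem mI xA) (max_independent_mem mJ xA) EIJ.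
by move/setP/(_ x): EIJ; rewrite !inE xA.
Qed.

Hypothesis cardA : #|~: A| = alpha G.

(** [mu] maps the complement of [A] injectively into [A]; equal cardinalities make it onto, so the
    matching is perfect. *)
Let mu_coverC a : a \in A -> mu a \notin A.
Proof.
have /eqP EA : mu @: (~: A) == A.
  rewrite eqEcard card_imset ?cardA ?alpha_cover ?leqnn ?andbT; last exact: can_inj muK.
  by apply/subsetP=> y /imsetP[x]; rewrite inE => /muA xA ->.
by rewrite -{1}EA => /imsetP[x]; rewrite inE => xA ->; rewrite muK.
Qed.

Lemma balanced_cover_perfect x : adj x (mu x).
Proof.
apply: mu_adj; apply/eqP=> Ex; have [xA|xA] := boolP (x \in A).
  by have:= mu_coverC xA; rewrite Ex xA.
by have:= muA xA; rewrite Ex (negbTE xA).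
Qed.

Lemma max_independent_transversal I x : I \in max_independent_sets G ->
  (mu x \in I) = (x \notin I).
Proof.
move=> mI; have [xA|xA] := boolP (x \in A).
  by rewrite (max_independent_mem mI xA) inE mu_coverC // negbK.
by rewrite (max_independent_mem mI (muA xA)) muK inE xA.
Qed.

End Matching.

(** * Transversals of a perfect matching and their complements *)

Definition transversals mu : {set {set G}} :=
  [set X : {set G} | [forall x, (mu x \in X) == (x \notin X)]].

Lemma transversalsP mu X :
  reflect (forall x, (mu x \in X) = (x \notin X)) (X \in transversals mu).
Proof.
by rewrite inE; apply: (iffP forallP) => H x; [apply/eqP | rewrite H].
Qed.

Lemma transversalC mu X : X \in transversals mu -> ~: X \in transversals mu.
Proof. by move/transversalsP=> tX; apply/transversalsP=> x; rewrite !inE tX. Qed.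

(** [mu] maps [X] onto its complement. *)
Lemma card_transversal mu X :
  involutive mu -> X \in transversals mu -> #|X|.*2 = #|G|.
Proof.
move=> muK /transversalsP tX; rewrite -addnn -[RHS](cardsC X); congr (_ + _).
rewrite -(card_imset X (can_inj muK)); apply: eq_card => x.
rewrite !inE -tX; apply/imsetP/idP => [[y yX ->]|xX]; first by rewrite muK.
by exists (mu x); rewrite ?muK.
Qed.

(** [A] contains one end of each matching edge, so a transversal is determined by its intersection
    with [A]. *)
Lemma card_transversals mu A : involutive mu -> A \in transversals mu ->
  #|transversals mu| <= 2 ^ #|A|.
Proof.
move=> muK /transversalsP tA.
rewrite -card_powerset -[leqLHS](card_in_imset (f := fun X => X :&: A)).
  apply: subset_leq_card; apply/subsetP=> _ /imsetP[X _ ->].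
  by rewrite powersetE subsetIr.
move=> X Y /transversalsP tX /transversalsP tY /setP EXY.
have EA x : x \in A -> (x \in X) = (x \in Y).
  by move=> xA; have:= EXY x; rewrite !inE xA !andbT.
apply/setP=> x; have [|xA] := boolP (x \in A); first exact: EA.
by have:= EA (mu x); rewrite tA xA tX tY => /(_ isT)/negb_inj.
Qed.

(** The side of one vertex [x0] determines the whole bipartition, by connectedness. *)
Lemma card_bipartitions :
  connected G -> #|[set X : {set G} | independent X & independent (~: X)]| <= 2.
Proof.
case=> /card_gt0P[x0 _] conn; rewrite -card_bool.
apply: (@leq_card_in _ _ (fun X : {set G} => x0 \in X)) => X Y.
have bip Z x y : Z \in [set X : {set G} | independent X & independent (~: X)] ->
    adj x y -> (x \in Z) = (y \notin Z).
  rewrite inE => /andP[/independentP iZ /independentP iZC] xy.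
  have:= iZ x y; have:= iZC x y; rewrite !inE xy.
  by case: (x \in Z); case: (y \in Z) => // H1 H2;
    first [have:= H1 isT isT | have:= H2 isT isT].
move=> mX mY E0; apply/setP=> x.
(* Both [X] and [Y] alternate along every edge, so the set where they agree is closed under
   adjacency. *)
pose a := [pred z | (z \in X) == (z \in Y)].
have cl : closed (@adj G) a.
  by move=> y z yz; rewrite !inE (bip X y z mX yz) (bip Y y z mY yz) (inj_eq negb_inj).
by have:= closed_connect cl (conn x0 x); rewrite !inE E0 eqxx => /esym/eqP.
Qed.


(** Inclusion-exclusion for the family and the family of complements: a set in both is a side of a
    bipartition, which happens at most twice. *)
Lemma card_max_independent_setsU : connected G ->
  #|max_independent_sets G|.*2 <=
    #|max_independent_sets G :|: [set ~: X | X in max_independent_sets G]| + 2.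
Proof.
move=> conn; set F := max_independent_sets G; set F' := imset _ _.
have cF' : #|F'| = #|F| by rewrite card_imset //; apply: setC_inj.
rewrite -addnn -{2}cF' -cardsUI leq_add2l.
apply: leq_trans (card_bipartitions conn); apply: subset_leq_card.
apply/subsetP=> X; rewrite !inE => /andP[/andP[iX _] /imsetP[Y]].
by rewrite inE => /andP[iY _] EX; rewrite iX EX setCK iY.
Qed.

Lemma alpha_gt0 : 0 < #|G| -> 0 < alpha G.
Proof.
case/card_gt0P=> x _; rewrite -(cards1 x); apply: leq_alpha.
by apply/independentP=> y z /set1P-> /set1P->; rewrite adj_irrefl.
Qed.

Lemma acyclic_perfect_matching : acyclic G ->
  2 ^ (alpha G - 1) < #|max_independent_sets G| ->
  exists mu, [/\ involutive mu, forall x, adj x (mu x),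
    max_independent_sets G \subset transversals mu &
    exists2 A, A \in transversals mu & #|A| = alpha G].
Proof.
move=> acG lt; have [A iA [mu [muK mu_adj muA]]] := acyclic_independent_matching acG.
have cA : #|~: A| = alpha G.
  apply/eqP; rewrite eqn_leq (card_compl_cover iA muK mu_adj muA) /= leqNgt.
  apply/negP=> ltA; move: lt; rewrite ltnNge => /negP; apply.
  apply: leq_trans (card_max_independent_sets_le iA muK mu_adj muA) _.
  by rewrite leq_exp2l // subn1 -ltnS (ltn_predK ltA).
have sF : max_independent_sets G \subset transversals mu.
  apply/subsetP=> I mI; apply/transversalsP=> x.
  exact: (max_independent_transversal iA).
exists mu; split=> //; first exact: (balanced_cover_perfect iA).
exists A; last by rewrite (alpha_cover iA muK).
by apply: (subsetP sF); rewrite inE iA (alpha_cover iA muK) /=.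
Qed.

(** * Structure of the unmatched edges in the equality case *)

Lemma extend_transversal mu A X : involutive mu -> A \in transversals mu ->
  {in X, forall x, mu x \notin X} ->
  exists2 Y, Y \in transversals mu & X \subset Y.
Proof.
move=> muK /transversalsP tA X_mu.
(* On the matching edges that [X] misses, the end in [A] is chosen. *)
exists [set x | (x \in X) || (x \in A) && (mu x \notin X)]; last first.
  by apply/subsetP=> x xX; rewrite inE xX.
apply/transversalsP=> x; rewrite !inE muK tA.
by have:= X_mu x; case: (x \in X); case: (x \in A); case: (mu x \in X) => //= /(_ isT).
Qed.

(* If xy and zw were disjoint unmatched edges, a transversal containing x, y and
   the mates of z, w would not be independent, and neither would its complement. *)
Lemma unmatched_edges_meet mu A : involutive mu -> A \in transversals mu ->
  (forall x, adj x (mu x)) ->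
  {in transversals mu, forall X, independent X || independent (~: X)} ->
  forall x y z w, adj x y -> y != mu x -> adj z w -> w != mu z ->
  (z \in [:: x; y]) || (w \in [:: x; y]).
Proof.
move=> muK tA mu_adj ext x y z w xy yx zw wz; apply: contraT.
rewrite !inE !negb_or => /andP[/andP[zx zy] /andP[wx wy]].
have mu_eq u v : (mu u == v) = (u == mu v) by rewrite -{1}(muK v) (inj_eq (can_inj muK)).
have mu_neq u : (u == mu u) = false by apply/negbTE/adj_neq.
have [|Y tY /subsetP sY] := @extend_transversal mu A [set x; y; mu z; mu w] muK tA.
  move=> u; rewrite !inE -!orbA => /or4P[]/eqP->;
  rewrite ?muK ?(inj_eq (can_inj muK)) ?mu_eq ?muK ?mu_neq !negb_or ?mu_neq ?andbT /=.
  - by rewrite [x == mu y]eq_sym mu_eq yx ![x == _]eq_sym zx.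
  - by rewrite yx ![y == _]eq_sym zy.
  - by rewrite zx zy eq_sym mu_eq wz.
  - by rewrite wx wy wz.
have [xY yY] : x \in Y /\ y \in Y by split; apply: sY; rewrite !inE eqxx ?orbT.
have [zY wY] : z \in ~: Y /\ w \in ~: Y.
  by split; rewrite inE -(transversalsP _ _ tY); apply: sY; rewrite !inE eqxx ?orbT.
case/orP: (ext Y tY) => /independentP iY; first by have:= iY x y xY yY; rewrite xy.
by have:= iY z w zY wY; rewrite zw.
Qed.

(** Pairwise meeting edges form a star or a triangle, and a triangle is a cycle. Without unmatched
    edges any vertex serves as centre. *)
Lemma unmatched_center mu : acyclic G -> 0 < #|G| ->
  involutive mu ->
  (forall x y z w, adj x y -> y != mu x -> adj z w -> w != mu z ->
     (z \in [:: x; y]) || (w \in [:: x; y])) ->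
  exists c, forall x y, adj x y -> y != mu x -> (x == c) || (y == c).
Proof.
move=> acG /card_gt0P[x0 _] muK meet.
pose center c := [forall x, forall y, adj x y ==> (y != mu x) ==> ((x == c) || (y == c))].
suff [c /forallP cP] : exists c, center c.
  by exists c => x y xy yx; move/forallP/(_ y)/implyP/(_ xy)/implyP: (cP x); apply.
have Ncenter c : ~~ center c ->
    exists x y, [/\ adj x y, y != mu x, x != c & y != c].
  case/forallPn=> x /forallPn[y]; rewrite !negb_imply negb_or.
  by case/and3P=> xy yx /andP[xc yc]; exists x, y.
have [|/Ncenter[x [y [xy yx _ _]]]] := boolP (center x0); first by exists x0.
have sym u v : v != mu u -> u != mu v by apply: contra => /eqP->; rewrite muK.
(* If [u] is not a centre, some unmatched edge avoids [u] and hence meets [uv] in [v]. Applied to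
   both ends of [xy], this gives edges [yz] and [xw], which can only meet in [z = w] and so close a
   triangle. *)
have through u v : adj u v -> v != mu u -> ~~ center u ->
    exists2 w, adj v w && (w != mu v) & w != u.
  move=> uv vu /Ncenter[z [t [zt tz zu tu]]].
  have:= meet _ _ _ _ uv vu zt tz; rewrite !inE (negbTE zu) (negbTE tu) /=.
  case/orP=> /eqP Ev; [exists t | exists z] => //; first by rewrite -Ev zt tz.
  by rewrite -Ev adj_sym zt sym.
have [|Nx] := boolP (center x); first by exists x.
have [|Ny] := boolP (center y); first by exists y.
have [z /andP[yz zy] zx] := through _ _ xy yx Nx.
have [||w /andP[xw wx] wy] := through y x _ _ Ny; [by rewrite adj_sym|exact: sym|].
have:= meet _ _ _ _ yz zy xw wx; rewrite !inE (negbTE wy) (negbTE (adj_neq xy)) /=.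
rewrite eq_sym (negbTE zx) /= => /eqP Ew; rewrite Ew in xw.
by case: (acyclic_triangle_free acG xy yz); rewrite adj_sym.
Qed.

End Graph.

(** * Recognition of the subdivided star *)

Lemma isomorphic_sym G H : isomorphic G H -> isomorphic H G.
Proof.
case=> f [g fK gK] f_adj; exists g; first by exists f.
by move=> x y; rewrite -f_adj !gK.
Qed.

Definition star_edge n (j : 'I_(n - 1)) : {set star n} := [set inl ord0; inr j].

Lemma star_edge_inj n : injective (@star_edge n).
Proof. by move=> j k /setP/(_ (inr j)); rewrite !inE eqxx => /esym/eqP[]. Qed.

Lemma mem_star_edge n (j k : 'I_(n - 1)) : (inr j \in star_edge k) = (j == k).
Proof. by rewrite !inE. Qed.

Lemma star_edgeP n (f : {set star n}) :
  f \in edges (star n) -> exists j, f = star_edge j.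
Proof.
rewrite inE => /existsP[x /existsP[y /andP[xy /eqP->]]].
case: x y xy => x [y|y] // _; [exists y | exists x];
  by rewrite /star_edge ?[x]ord1 ?[y]ord1 // setUC.
Qed.

Lemma spider_isomorphic (G : sgraph) (mu : G -> G) (c : G) n :
  connected G -> acyclic G -> involutive mu -> (forall x, adj x (mu x)) ->
  (forall x y : G, adj x y -> y != mu x -> (x == c) || (y == c)) ->
  #|G| = (n - 1).*2 ->
  exists S : {set {set star n}},
    [/\ S \subset edges (star n), #|S| = n - 1 - 1 & isomorphic G (subdivide S)].
Proof.
move=> [_ conn] acG muK mu_adj ctr cG.
have mu_eq u v : (mu u == v) = (u == mu v) by rewrite -{1}(muK v) (inj_eq (can_inj muK)).
have mu_neq u : (u == mu u) = false by apply/negbTE/adj_neq.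
have mu_inj := can_inj muK.
(* [D] will be the set of subdivision vertices and [L] the set of leaves, which includes [mu c]. *)
pose D := [set d | adj c d & d != mu c].
pose L := [set v | (v != c) && (v \notin D)].
have triangle d : adj c d -> adj c (mu d) -> False.
  by move=> cd cmd; apply: (acyclic_triangle_free acG cd (mu_adj d)); rewrite adj_sym.
(* Every unmatched edge contains [c], so otherwise [v] and [mu v] would form a component without
   [c]. *)
have adj_pair v : v != c -> v != mu c -> adj c v || adj c (mu v).
  move=> vc vmc; apply: contraT; rewrite negb_or => /andP[Nv Nmv].
  have cl : closed (@adj G) (mem [set v; mu v]).
    apply: intro_closed; first exact/sym_connect_sym/adj_sym.
    have step u : u != c -> ~~ adj c u -> forall w, adj u w -> w = mu u.
      move=> uc Ncu w uw; apply/eqP; apply: contraT => wu.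
      have:= ctr _ _ uw wu; rewrite (negbTE uc) /= => /eqP Ew.
      by rewrite -Ew adj_sym uw in Ncu.
    move=> x y xy; rewrite !inE => /orP[]/eqP Ex; rewrite Ex in xy.
      by rewrite (step _ vc Nv _ xy) eqxx orbT.
    have mvc : mu v != c by rewrite mu_eq.
    by rewrite (step _ mvc Nmv _ xy) muK eqxx.
  have:= closed_connect cl (conn v c); rewrite !inE eqxx /= => /esym/orP[]/eqP Ec.
    by rewrite -Ec eqxx in vc.
  by rewrite Ec muK eqxx in vmc.
(* Exactly one end of each matching edge avoiding [c] is adjacent to [c]: at least one by
   [adj_pair], at most one since there is no triangle. *)
have tL : L \in transversals mu.
  apply/transversalsP=> v; rewrite !inE mu_eq !negb_and !negbK (inj_eq mu_inj).
  have [->|vc] := eqVneq v c; first by rewrite adj_irrefl orbT -mu_eq eq_sym mu_neq.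
  have [Ev|vmc] := eqVneq v (mu c); first by rewrite orbT.
  rewrite /= !orbF negbK; have:= adj_pair v vc vmc; have:= triangle v.
  by case: (adj c v); case: (adj c _) => // /(_ isT isT).
have tLP := transversalsP _ _ tL.
have cL : n - 1 = #|L|.
  by apply: double_inj; rewrite (card_transversal muK tL) cG.
pose leaf (j : 'I_(n - 1)) : G := enum_val (cast_ord cL j).
have leafL j : leaf j \in L by apply: enum_valP.
have leaf_inj : injective leaf by move=> j k /enum_val_inj/cast_ord_inj.
have leafN j : (mu (leaf j) \in L) = false by rewrite tLP leafL.
have leafc j : leaf j != c by have:= leafL j; rewrite inE => /andP[].
have adj_leaf j y : adj (leaf j) y = (y == mu (leaf j)).
  apply/idP/eqP => [jy|->]; last exact: mu_adj.
  apply/eqP; apply: contraT => Ny; have:= ctr _ _ jy Ny.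
  rewrite (negbTE (leafc j)) /= => /eqP Ey.
  have:= leafL j; rewrite !inE leafc adj_sym -Ey jy /= negbK => /eqP Ej.
  by move: Ny; rewrite Ej muK eqxx.
(* The matching edge at [c] is the one star edge left unsubdivided. *)
have [j0 Ej0] : exists j0, leaf j0 = mu c.
  have mcL : mu c \in L by rewrite tLP !inE eqxx.
  exists (cast_ord (esym cL) (enum_rank_in mcL (mu c))).
  by rewrite /leaf cast_ord_comp cast_ord_id enum_rankK_in.
pose S := [set star_edge j | j in [set~ j0]].
have memS j : (star_edge j \in S) = (j != j0).
  by rewrite mem_imset ?inE //; apply: star_edge_inj.
have cS : #|S| = n - 1 - 1.
  by rewrite card_imset; [rewrite cardsC1 card_ord !subn1 | exact: star_edge_inj].
exists S; split=> //.
  apply/subsetP=> _ /imsetP[j _ ->]; rewrite inE; apply/existsP; exists (inl ord0).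
  by apply/existsP; exists (inr j); rewrite /= eqxx.
apply: isomorphic_sym.
(* The new vertex on the edge to leaf [j] goes to the mate of that leaf. The default [c] never
   occurs, by [g_inr]. *)
pose g (u : subdivide S) : G := match u with
  | inl (inl _) => c
  | inl (inr j) => leaf j
  | inr f => if [pick j | inr j \in val f] is Some j then mu (leaf j) else c
  end.
have g_inr f : exists j, [/\ val f = star_edge j, j != j0 & g (inr f) = mu (leaf j)].
  have /imsetP[j] := valP f; rewrite !inE => jj0 Ef; exists j; split=> //=.
  case: pickP => [k|/(_ j)]; rewrite Ef mem_star_edge ?eqxx //.
  by move/eqP->.
have adj_c_mid j : j != j0 -> adj c (mu (leaf j)).
  move=> jj0; have:= leafN j; rewrite !inE mu_eq -Ej0 (inj_eq leaf_inj) jj0 /=.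
  by move/negbFE/andP=> [].
exists g; last first.
  have c_leaf j : adj c (leaf j) = (star_edge j \notin S).
    by rewrite memS negbK adj_sym adj_leaf -(inj_eq leaf_inj) Ej0 eq_sym mu_eq.
  case=> [[i|j]|f] [[i'|k]|f'].
  - by rewrite /= adj_irrefl.
  - by rewrite /= c_leaf [i]ord1.
  - have [k [Ef kj0 ->]] := g_inr f'; rewrite /= Ef.
    by rewrite adj_c_mid // [i]ord1 !inE.
  - by rewrite /= adj_sym c_leaf [i']ord1 setUC.
  - by rewrite /= adj_leaf; apply: contraFF (leafN j) => /eqP<-.
  - have [k [Ef kj0 ->]] := g_inr f'; rewrite /= Ef.
    by rewrite adj_leaf mem_star_edge (inj_eq mu_inj) (inj_eq leaf_inj) eq_sym.
  - have [k [Ef kj0 ->]] := g_inr f; rewrite /= Ef.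
    by rewrite adj_sym adj_c_mid // [i']ord1 !inE.
  - have [j [Ef jj0 ->]] := g_inr f; rewrite /= Ef.
    by rewrite adj_sym adj_leaf mem_star_edge (inj_eq mu_inj) (inj_eq leaf_inj) eq_sym.
  (* An edge between two subdivision vertices would be unmatched and avoid [c]. *)
  - have [j [_ jj0 ->]] := g_inr f; have [k [_ kj0 ->]] := g_inr f'.
    apply/negbTE/negP=> mm; have Nc i : i != j0 -> mu (leaf i) == c = false.
      by rewrite mu_eq -Ej0 (inj_eq leaf_inj) => /negbTE.
    have [Ek|Nk] := eqVneq (mu (leaf k)) (leaf j).
      by have:= leafN k; rewrite Ek leafL.
    by have:= ctr _ _ mm; rewrite muK !Nc // => /(_ Nk).
(* Both graphs have [1 + (n - 1) + (n - 2)] vertices; [j0] witnesses that [n - 1] is positive. *)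
apply: inj_card_bij; last first.
  rewrite card_sum card_sum !card_ord card_sig cS cG -addnn add1n addSnnS leq_add2l.
  by case: (n - 1) (leq_ltn_trans (leq0n _) (ltn_ord j0)) => // m _; rewrite subn1.
have cL_neq j : c = leaf j -> False by move=> Ec; have:= leafc j; rewrite Ec eqxx.
have cM_neq j : j != j0 -> c = mu (leaf j) -> False.
  by move=> jj0 Ec; move: jj0; rewrite -(inj_eq leaf_inj) Ej0 Ec muK eqxx.
have LM_neq j k : leaf j = mu (leaf k) -> False.
  by move=> E; have:= leafN k; rewrite -E leafL.
case=> [[i|j]|f] [[i'|k]|f'].
- by rewrite [i]ord1 [i']ord1.
- by move/cL_neq.
- by have [k [_ kj0 ->]] := g_inr f' => /(cM_neq _ kj0).
- by move/esym/cL_neq.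
- by move/leaf_inj->.
- by have [k [_ _ ->]] := g_inr f' => /LM_neq.
- by have [j [_ jj0 ->]] := g_inr f => /esym/(cM_neq _ jj0).
- by have [j [_ _ ->]] := g_inr f => /esym/LM_neq.
- have [j [Ef _ ->]] := g_inr f; have [k [Ef' _ ->]] := g_inr f'.
  by move/mu_inj/leaf_inj=> Ej; congr inr; apply: val_inj; rewrite Ef Ef' Ej.
Qed.

(** * Independent sets of the subdivided star *)

(** With [k] a parameter, the independence number of the subdivided star need not be computed;
    [k = alpha T] gives [max_independent_sets T] by conversion. *)
Definition independent_sets_of_card (G : sgraph) k : {set {set G}} :=
  [set X : {set G} | independent X & #|X| == k].

Lemma isomorphic_card_independent G H k : isomorphic G H ->
  #|independent_sets_of_card H k| <= #|independent_sets_of_card G k|.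
Proof.
case=> f [g fK gK] f_adj.
have pre_inj : injective (fun X : {set H} => f @^-1: X).
  by move=> X Y /setP E; apply/setP=> x; have:= E (g x); rewrite !inE gK.
rewrite -(card_imset _ pre_inj); apply: subset_leq_card.
apply/subsetP=> Y /imsetP[X]; rewrite inE => /andP[/independentP iX cX] ->{Y}.
rewrite inE on_card_preimset; last by exists g => x _.
rewrite cX andbT; apply/independentP=> x y; rewrite !inE => xX yX.
by rewrite -f_adj iX.
Qed.

(** Choosing on each subdivided edge the new vertex or the leaf, together with the leaf [j0] of the
    unsubdivided edge, gives [2 ^ (n - 2)] sets [X Q]. One more, [X1], consists of the centre and
    all leaves but [j0]. *)
Lemma card_independent_subdivided_star n (S : {set {set star n}}) :
  S \subset edges (star n) -> 1 < n -> #|S| = n - 1 - 1 ->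
  2 ^ (n - 1 - 1) + 1 <= #|independent_sets_of_card (subdivide S) (n - 1)|.
Proof.
move=> /subsetP sS n1 cS.
have [leg leg_edge] : exists leg : {f | f \in S} -> 'I_(n - 1),
    forall f, val f = star_edge (leg f).
  apply: (@fin_all_exists _ (fun=> 'I_(n - 1)) (fun f j => val f = star_edge j)).
  by move=> f; apply: star_edgeP; apply: sS; apply: valP.
have leg_inj : injective leg.
  by move=> f f' E; apply: val_inj; rewrite !leg_edge E.
have cleg : #|leg @: setT| = n - 1 - 1.
  by rewrite card_imset // cardsT card_sig cS.
(* Of the [n - 1] edges, [n - 2] are subdivided, which leaves one. *)
have [j0 Ej0] : exists j0, ~: (leg @: setT) = [set j0].
  apply/cards1P; have:= cardsC (leg @: setT); rewrite cleg card_ord => E.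
  rewrite -(eqn_add2l (n - 1 - 1)) E subnK // subn_gt0 //.
pose lf (j : 'I_(n - 1)) : subdivide S := inl (inr j).
pose X (Q : {set {f | f \in S}}) : {set subdivide S} :=
  [set inr f | f in Q] :|: [set lf j | j in ~: (leg @: Q)].
pose X1 : {set subdivide S} := inl (inl ord0) |: [set lf j | j in [set~ j0]].
have lf_inj : injective lf by move=> j k [].
have inr_inj : injective (@inr (star n) {f | f \in S}) by move=> f f' [].
have memX Q f : ((inr f : subdivide S) \in X Q) = (f \in Q).
  rewrite inE (mem_imset _ _ inr_inj); case: imsetP => [[] //|_]; exact: orbF.
have X_inj : injective X.
  by move=> Q Q' /setP E; apply/setP=> f; rewrite -!memX E.
have cX Q : #|X Q| = n - 1.
  rewrite cardsU (_ : _ :&: _ = set0) ?cards0 ?subn0; last first.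
    apply/setP=> u; rewrite !inE; apply/negP=> /andP[/imsetP[f _ ->] /imsetP[]] //.
  rewrite (card_imset _ inr_inj) (card_imset _ lf_inj) -(card_imset _ leg_inj).
  by rewrite cardsC card_ord.
have cX1 : #|X1| = n - 1.
  rewrite cardsU1 (card_imset _ lf_inj) cardsC1 card_ord.
  case: imsetP => [[] //|_]; rewrite add1n prednK // subn_gt0 //.
have iX Q : independent (X Q).
  have leg_lf f j : f \in Q -> j \in ~: (leg @: Q) -> inr j \notin val f.
    move=> fQ; rewrite leg_edge mem_star_edge inE; apply: contra => /eqP->.
    exact: imset_f.
  apply/independentP=> u v.
  case/setUP=> /imsetP[a aQ ->] /setUP[]/imsetP[b bQ ->] //=; exact: leg_lf.
have iX1 : independent X1.
  have c_lf j : j \in [set~ j0] -> ~~ subdivide_adj (S := S) (inl (inl ord0)) (lf j).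
    rewrite !inE => jj0 /=; rewrite negbK.
    have : j \notin ~: (leg @: setT) by rewrite Ej0 inE.
    by rewrite inE negbK => /imsetP[f _ ->]; rewrite -/(star_edge _) -leg_edge (valP f).
  apply/independentP=> u v.
  case/setU1P=> [->|/imsetP[j jj0 ->]] /setU1P[->|/imsetP[k kj0 ->]] //.
    exact: c_lf.
  by rewrite adj_sym; apply: c_lf.
have X1N : X1 \notin X @: setT.
  apply/imsetP=> -[Q _] /setP/(_ (inl (inl ord0))); rewrite setU11 => /esym/setUP[].
    by case/imsetP.
  by case/imsetP.
have <- : #|X1 |: X @: setT| = 2 ^ (n - 1 - 1) + 1.
  by rewrite cardsU1 X1N card_imset // addnC -powersetT card_powerset cardsT card_sig cS.
apply: subset_leq_card; apply/subsetP=> _ /setU1P[->|/imsetP[Q _ ->]].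
  by rewrite inE iX1 cX1 eqxx.
by rewrite inE iX cX eqxx.
Qed.

(** * The bound and its equality case *)

Theorem theorem2 (T : sgraph) (hT : is_tree T) :
  #|max_independent_sets T| <= 2 ^ (alpha T - 1) + 1 /\
  (#|max_independent_sets T| = 2 ^ (alpha T - 1) + 1 <->
   exists S : {set {set star (alpha T + 1)}},
     [/\ S \subset edges (star (alpha T + 1)), #|S| = alpha T - 1
       & isomorphic T (subdivide S)]).
Proof.
have [connT acT] := hT; have a0 := alpha_gt0 (proj1 connT).
have double_pow : (2 ^ (alpha T - 1) + 1).*2 = 2 ^ alpha T + 2.
  by rewrite doubleD -mul2n -expnS subn1 prednK.
set F := max_independent_sets T; pose F' := [set ~: X | X in F].
have FU_sub mu : F \subset transversals mu -> F :|: F' \subset transversals mu.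
  move=> sF; rewrite subUset sF; apply/subsetP=> _ /imsetP[X XF ->].
  exact/transversalC/(subsetP sF).
have upper : #|F| <= 2 ^ (alpha T - 1) + 1.
  have [small|big] := leqP #|F| (2 ^ (alpha T - 1)).
    by apply: leq_trans small _; rewrite leq_addr.
  have [mu [muK _ /FU_sub sF [A tA cA]]] := acyclic_perfect_matching acT big.
  rewrite -leq_double double_pow (leq_trans (card_max_independent_setsU connT)) //.
  rewrite leq_add2r -cA (leq_trans _ (card_transversals muK tA)) //.
  exact: subset_leq_card.
split=> //; split=> [EF|[S [sS cS iso]]]; last first.
  apply/eqP; rewrite eqn_leq upper.
  have E : alpha T = alpha T + 1 - 1 by rewrite addnK.
  rewrite {1}E; apply: leq_trans (card_independent_subdivided_star sS _ _) _.
  - by rewrite addn1 ltnS.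
  - by rewrite -E.
  by rewrite -E; apply: (isomorphic_card_independent _ iso).
have big : 2 ^ (alpha T - 1) < #|F| by rewrite EF addn1.
have [mu [muK mu_adj sF [A tA cA]]] := acyclic_perfect_matching acT big.
(* Twice [#|F|] is [2 ^ alpha T + 2], so the union has at least [2 ^ alpha T] members, as many as
   there can be transversals. *)
have EU : F :|: F' = transversals mu.
  apply/eqP; rewrite eqEcard FU_sub // (leq_trans (card_transversals muK tA)) //.
  rewrite cA -(leq_add2r 2) -double_pow -EF.
  exact: card_max_independent_setsU.
have ext : {in transversals mu, forall X, independent X || independent (~: X)}.
  move=> X; rewrite -EU => /setUP[|/imsetP[Y]]; rewrite inE => /andP[iX _].
    by rewrite iX.
  by move=> ->; rewrite setCK iX orbT.
have meet := unmatched_edges_meet muK tA mu_adj ext.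
have [c ctr] := unmatched_center acT (proj1 connT) muK meet.
have E : alpha T = alpha T + 1 - 1 by rewrite addnK.
have [|S [sS cS iso]] := @spider_isomorphic T mu c (alpha T + 1) connT acT muK mu_adj ctr.
  by rewrite -E -cA (card_transversal muK tA).
by exists S; split=> //; rewrite cS -E.
Qed.
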